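(* For $t\in\mathbb{R}^{\times}=\mathbb{R}\setminus\{0\}$ let $s(t)=(U_1(t),V_1(t),W_1(t),\ldots,U_{48}(t),V_{48}(t),W_{48}(t))$ be the explicit family of triples of real $4\times4$ matrices listed in the context (all of whose entries are rational functions of $t$ with rational coefficients and with poles at most at $t=0$). Then: (i) For every $t\in\mathbb{R}^{\times}$, $$\sum_{i=1}^{48}U_i(t)\otimes V_i(t)\otimes W_i(t)=\langle 4,4,4\rangle ,$$ i.e. $s(t)\in \mathrm{V}(4,4,4|48)$. (ii) If $t_1\neq t_2$ both lie in the same one of the intervals $(-\infty,-\tfrac14]$, $[-\tfrac14,0)$, $(0,\tfrac14]$, $[\tfrac14,+\infty)$, then $s(t_1)$ and $s(t_2)$ belong to distinct $\mathcal{I}(4,4,4|48)$-orbits. In particular, the points $s(t)$ with $t\in\mathbb{Q}\cap[\tfrac14,+\infty)$ are infinitely many pairwise inequivalent (i.e. lying in pairwise distinct $\mathcal{I}(4,4,4|48)$-orbits) $48$-multiplication algorithms for multiplying two $4\times4$ matrices, all with rational coefficients.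
   Context: Matrix multiplication tensor: $\langle 4,4,4\rangle=\sum_{i,j,k=1}^{4}e_{ij}\otimes e_{jk}\otimes e_{ki}\in(\mathbb{R}^{4\times4})^{\otimes3}$, where $e_{ij}$ is the matrix unit. $\mathrm{V}(4,4,4|48)$ is the set of all $s=(U_1,V_1,W_1,\ldots,U_{48},V_{48},W_{48})$, $U_i,V_i,W_i\in\mathbb{R}^{4\times4}$, with $\sum_{i=1}^{48}U_i\otimes V_i\otimes W_i=\langle4,4,4\rangle$; such $s$ is a $48$-multiplication algorithm. The isotropy group $\mathcal{I}(4,4,4|48)$ is the group of transformations of $\mathrm{V}(4,4,4|48)$ generated by: (1) de Groote actions: for $A,B,C\in \mathrm{GL}_4(\mathbb{R})$, $(U_i,V_i,W_i)_i\mapsto(AU_iB^{-1},BV_iC^{-1},CW_iA^{-1})_i$; (2) layer scalings: for $\lambda_i,\mu_i\in\mathbb{R}^\times$, $(U_i,V_i,W_i)_i\mapsto(\lambda_iU_i,\mu_iV_i,(\lambda_i\mu_i)^{-1}W_i)_i$; (3) permutations of the 48 layers $(U_i,V_i,W_i)$; (4) the $S_3$-symmetry generated by $(U_i,V_i,W_i)_i\mapsto(W_i,U_i,V_i)_i$ and $(U_i,V_i,W_i)_i\mapsto(U_i^t,W_i^t,V_i^t)_i$ (here the superscript $t$ is transpose). The family $s(t)$. Matrices are written row by row, rows separated by semicolons; a row written as a single $0$ is the zero row $(0,0,0,0)$; a scalar in front of a bracket multiplies the whole matrix. $i=1$: $U=[-1,1,1,1;-1,1,1,1;1,-1,-1,-1;-1,1,1,1]$,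 $V=[0;0;1,0,0,0;1,0,0,0]$, $W=\frac14[0,0,-1,1;0,0,1,-1;0,0,1-4t,4t-1;0,0,-1,1]$. $i=2$: $U=[-1,0,0,0;1,0,0,0;1,0,0,0;-1,0,0,0]$, $V=[0,1,0,1;0,-1,0,-1;0;0]$, $W=\frac1{8t}[-1,1,0,0;0;0;-4t,4t,0,0]$. $i=3$: $U=[0,0,-1,0;0,0,1,0;0,0,1,0;0,0,1,0]$, $V=[0,1,0,0;0;0,1,0,0;0]$, $W=\frac12[0;0,1,0,1;0,-4t,0,-4t;0,4t-1,0,4t-1]$. $i=4$: $U=[0,0,-1,-1;0,0,-1,-1;0,0,1,-1;0,0,1,-1]$, $V=\frac14[0;0;0,4t,1,0;4t,0,-1,0]$, $W=\frac1{2t}[0;-1,-1,0,0;2t,2t,2t,2t;1-2t,1-2t,-2t,-2t]$. $i=5$: $U=[1,1,1,-1;-1,-1,-1,1;1,1,1,-1;1,1,1,-1]$, $V=[-4t,0,1,1;-4t,0,1,1;0;0]$, $W=\frac14[0;0;0;0,0,1,1]$. $i=6$: $U=[1,1,-1,1;-1,-1,1,-1;-1,-1,1,-1;1,1,-1,1]$, $V=[0;0,1,0,1;0;0,1,0,1]$, $W=\frac14[0,1,0,-1;0,-1,0,1;0,4t,0,-4t;0]$. $i=7$: $U=[0,0,0,-1;0,0,0,1;0,0,0,1;0,0,0,1]$, $V=[0;0,1,0,0;0;0,-1,0,0]$, $W=\frac12[0;1,0,-1,0;0;-1,0,1,0]$. $i=8$: $U=[1,1,1,-1;-1,-1,-1,1;1,1,1,-1;-1,-1,-1,1]$,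 $V=[4t,4t-1,0,-1;0;4t,4t-1,0,-1;0]$, $W=\frac14[0;0;0;0,1,0,1]$. $i=9$: $U=[0,0,-1,-1;0,0,1,1;-1,1,0,0;-1,1,0,0]$, $V=[4t,1,-1,-1;-4t,-1,1,1;-4t,1,1,1;-4t,1,1,1]$, $W=\frac18[1,-1,1,1;-1,1,-1,-1;4t-2,2-4t,4t,4t;1,-1,1,1]$. $i=10$: $U=[1,0,0,0;1,0,0,0;1,0,0,0;-1,0,0,0]$, $V=[1-4t,1,1,1;0;4t-1,-1,-1,-1;0]$, $W=\frac12[1,0,1,0;0;0;4t,0,4t,0]$. $i=11$: $U=[-1,-1,-1,1;1,1,1,-1;1,1,1,-1;-1,-1,-1,1]$, $V=[0;0,1,0,1;0;0,-1,0,-1]$, $W=\frac14[0;0;0;-1,0,1,0]$. $i=12$: $U=[0,1,0,1;-1,0,1,0;0,1,0,1;-1,0,1,0]$, $V=[-4t,1-8t,-1,1;4t,-1,-1,-1;4t,8t-1,1,-1;4t,-1,-1,-1]$, $W=\frac18[2,0,2,0;-2,0,-2,0;8t-1,1,8t-1,1;1,-1,1,-1]$. $i=13$: $U=[0,0,1,0;0,0,-1,0;0,0,1,0;0,0,1,0]$, $V=[4t,0,-1,-1;0;-4t,0,1,1;0]$, $W=\frac12[0;-1,0,-1,0;4t,0,4t,0;1-4t,0,1-4t,0]$. $i=14$: $U=[0,0,1,0;0,0,1,0;0,0,-1,0;0,0,-1,0]$, $V=[0;0;4t,0,-1,0;-4t,0,1,0]$, $W=\frac1{8t}[0;1,1,0,0;-4t,-4t,0,0;4t-1,4t-1,0,0]$.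 $i=15$: $U=[1,0,1,0;1,0,-1,0;-1,0,-1,0;1,0,-1,0]$, $V=[0,1,0,0;0;-1,0,0,0;0]$, $W=\frac14[-1,1,1,1;1,1,-1,1;-4t,-4t,4t,-4t;-1,8t-1,1,8t-1]$. $i=16$: $U=[1,1,-1,1;-1,-1,1,-1;1,1,-1,1;-1,-1,1,-1]$, $V=[4t,4t-1,0,-1;0;-4t,1-4t,0,1;0]$, $W=\frac14[1,0,1,0;-1,0,-1,0;4t,0,4t,0;0]$. $i=17$: $U=[1,1,0,0;1,1,0,0;-1,1,0,0;-1,1,0,0]$, $V=[0,-4t,-1,0;4t,0,-1,0;0;0]$, $W=\frac1{8t}[0,0,1,1;0;-2t,-2t,2t,2t;2t,2t,2t,2t]$. $i=18$: $U=[-1,1,1,1;-1,1,1,1;1,-1,-1,-1;1,-1,-1,-1]$, $V=[0;4t,0,-1,0;0;4t,0,-1,0]$, $W=\frac14[0,1,0,-1;0,-1,0,1;0,4t-1,0,1-4t;0,1,0,-1]$. $i=19$: $U=[0,1,0,1;-1,0,1,0;0,-1,0,-1;1,0,-1,0]$, $V=[4t,-1,-1,-1;4t,1,-1,1;-4t,1,1,1;4t,1,-1,1]$, $W=\frac18[0,-2,0,2;0,2,0,-2;-1,1-8t,1,8t-1;1,-1,-1,1]$. $i=20$: $U=[-1,1,-1,-1;-1,1,-1,-1;1,-1,1,1;1,-1,1,1]$, $V=[0;-4t,0,1,0;0;4t,0,-1,0]$, $W=\frac14[0;0;1,0,-1,0;0]$. $i=21$: $U=[0,0,1,0;0,0,-1,0;0,0,-1,0;0,0,1,0]$,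 $V=[0;0;0,1,0,1;0,1,0,1]$, $W=\frac1{8t}[0;0,0,-1,1;0,0,4t,-4t;0,0,1-4t,4t-1]$. $i=22$: $U=[1,0,1,0;0,-1,0,1;1,0,1,0;0,-1,0,1]$, $V=[4t,8t-1,1,-1;-4t,1,1,1;4t,8t-1,1,-1;4t,-1,-1,-1]$, $W=\frac18[0;0;1,-1,1,-1;-1,-1,-1,-1]$. $i=23$: $U=[0,0,0,1;0,0,0,-1;0,0,0,1;0,0,0,1]$, $V=[0;-4t,0,1,1;0;-4t,0,1,1]$, $W=\frac12[0;0,1,0,-1;0;0,-1,0,1]$. $i=24$: $U=[1,-1,1,1;-1,1,-1,-1;1,-1,1,1;1,-1,1,1]$, $V=[4t,0,-1,-1;-4t,0,1,1;0;0]$, $W=\frac14[0;0;-1,1,0,0;0]$. $i=25$: $U=[1,1,0,0;-1,-1,0,0;0,0,1,-1;0,0,1,-1]$, $V=[4t,1,-1,-1;4t,1,-1,-1;-4t,1,1,1;4t,-1,-1,-1]$, $W=\frac18[-1,1,-1,-1;1,-1,1,1;-4t,4t,-4t,-4t;-1,1,1,1]$. $i=26$: $U=[1,-1,1,1;1,-1,1,1;1,-1,1,1;-1,1,-1,-1]$, $V=[0;0;1-4t,1,1,1;1-4t,1,1,1]$, $W=\frac14[0;0;0,0,1,-1;0]$. $i=27$: $U=[0,1,0,0;0,1,0,0;0,1,0,0;0,1,0,0]$, $V=\frac1{4t}[0,4t,1,0;0,4t,1,0;0;0]$, $W=\frac12[0,0,1,1;0;0,0,4t,4t;0]$. $i=28$: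 $U=[0,0,1,1;0,0,1,1;1,-1,0,0;-1,1,0,0]$, $V=[4t,-1,-1,-1;-4t,1,1,1;2-4t,1,1,1;2-4t,1,1,1]$, $W=\frac18[1,1,1,-1;-1,-1,-1,1;4t,4t,4t-2,2-4t;1,1,1,-1]$. $i=29$: $U=[1,-1,-1,-1;-1,1,1,1;-1,1,1,1;-1,1,1,1]$, $V=[0,-1,0,0;0,1,0,0;0;0]$, $W=\frac14[1,-1,0,0;-1,1,0,0;4t-1,1-4t,0,0;1,-1,0,0]$. $i=30$: $U=[0,0,0,1;0,0,0,1;0,0,0,1;0,0,0,1]$, $V=\frac1{4t}[0;0;0,-4t,-1,0;0,4t,1,0]$, $W=\frac12[0;1,1,0,0;0;-1,-1,0,0]$. $i=31$: $U=[0,1,0,0;0,-1,0,0;0,1,0,0;0,-1,0,0]$, $V=\frac1{4t}[4t,4t-1,0,-1;-4t,1-4t,0,1;0;0]$, $W=\frac12[-1,1,0,0;0;-4t,4t,0,0;0]$. $i=32$: $U=[1,0,1,0;0,-1,0,1;-1,0,-1,0;0,1,0,-1]$, $V=[4t,-1,-1,-1;4t,1,-1,1;4t,-1,-1,-1;-4t,-1,1,-1]$, $W=\frac18[0;0;-1,1,1,-1;-1,-1,1,1]$. $i=33$: $U=[-1,-1,1,-1;1,1,-1,1;1,1,-1,1;1,1,-1,1]$, $V=[0,-1,0,0;0,-1,0,0;0;0]$, $W=\frac14[0,0,1,1;0,0,-1,-1;0,0,4t,4t;0]$. $i=34$: $U=[0,0,-1,-1;0,0,1,1;0,0,1,-1;0,0,-1,1]$,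 $V=[0;0;-4t,1-4t,0,1;0,1,0,1]$, $W=\frac1{8t}[0;0,0,-1,1;2t,-2t,2t,-2t;-2t,2t,1-2t,2t-1]$. $i=35$: $U=[1,1,0,0;1,1,0,0;0,0,1,-1;0,0,-1,1]$, $V=[-4t,1,1,1;-4t,1,1,1;4t-2,-1,-1,-1;2-4t,1,1,1]$, $W=\frac18[-1,-1,-1,1;1,1,1,-1;-4t,-4t,-4t,4t;1,1,-1,1]$. $i=36$: $U=[1,-1,1,1;1,-1,1,1;1,-1,1,1;1,-1,1,1]$, $V=[0,4t,1,0;0;0,4t,1,0;0]$, $W=\frac14[0;0;0,1,0,1;0]$. $i=37$: $U=[0,1,0,0;0,1,0,0;0,1,0,0;0,-1,0,0]$, $V=[0;1-4t,1,1,1;0;1-4t,1,1,1]$, $W=\frac12[0,1,0,-1;0;0,4t,0,-4t;0]$. $i=38$: $U=[0,1,0,1;0,1,0,-1;0,1,0,1;0,-1,0,1]$, $V=[0;-4t,0,1,1;0;1-4t,1,1,1]$, $W=\frac14[1,-1,1,1;-1,-1,-1,1;4t,-4t,4t,4t;1,1,1,-1]$. $i=39$: $U=[0,1,0,0;0,1,0,0;0,-1,0,0;0,1,0,0]$, $V=[0;-1,0,0,0;0;1,0,0,0]$, $W=\frac12[-1,0,1,0;0;-4t,0,4t,0;0]$. $i=40$: $U=[-1,-1,0,0;1,1,0,0;1,-1,0,0;-1,1,0,0]$, $V=[4t,4t-1,0,-1;0,1,0,1;0;0]$, $W=\frac1{8t}[-1,1,0,0;0;-2t,2t,2t,-2t;-2t,2t,-2t,2t]$.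 $i=41$: $U=[-1,1,1,1;-1,1,1,1;-1,1,1,1;-1,1,1,1]$, $V=[0,4t,1,0;0;0,-4t,-1,0;0]$, $W=\frac14[1,0,1,0;-1,0,-1,0;4t-1,0,4t-1,0;1,0,1,0]$. $i=42$: $U=[0,0,0,1;0,0,0,-1;0,0,0,1;0,0,0,-1]$, $V=\frac1{4t}[0;0;4t,4t-1,0,-1;4t,4t-1,0,-1]$, $W=\frac12[0;0,0,1,-1;0;0,0,-1,1]$. $i=43$: $U=[1,0,0,0;1,0,0,0;-1,0,0,0;1,0,0,0]$, $V=[1,0,0,0;0;1,0,0,0;0]$, $W=\frac12[0,1,0,1;0;0;0,4t,0,4t]$. $i=44$: $U=[1,0,1,0;1,0,-1,0;1,0,1,0;-1,0,1,0]$, $V=[4t,0,-1,-1;0;1-4t,1,1,1;0]$, $W=\frac14[1,-1,1,1;1,1,1,-1;-4t,-4t,-4t,4t;8t-1,-1,8t-1,1]$. $i=45$: $U=[1,1,-1,1;1,1,-1,1;-1,-1,1,-1;1,1,-1,1]$, $V=[0;0;-1,0,0,0;1,0,0,0]$, $W=\frac14[1,1,0,0;-1,-1,0,0;4t,4t,0,0;0]$. $i=46$: $U=[1,1,1,-1;1,1,1,-1;1,1,1,-1;-1,-1,-1,1]$, $V=[0;0;1-4t,1,1,1;4t-1,-1,-1,-1]$, $W=\frac14[0;0;0;1,1,0,0]$. $i=47$: $U=[-1,0,0,0;-1,0,0,0;1,0,0,0;1,0,0,0]$, $V=\frac1{4t}[4t,0,-1,0;4t,0,-1,0;0;0]$,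 $W=\frac12[0,0,1,1;0;0;0,0,4t,4t]$. $i=48$: $U=[0,-1,0,-1;0,-1,0,1;0,1,0,1;0,-1,0,1]$, $V=[0;0,1,0,0;0;1,0,0,0]$, $W=\frac14[-1,1,1,1;-1,-1,1,-1;-4t,4t,4t,4t;1,1,-1,1]$. *)

(* Defs.v *)
From HB Require Import structures.
From mathcomp Require Import all_boot all_order all_algebra all_fingroup.
From mathcomp Require Import mxtens.
From mathcomp Require Import all_classical all_reals.

Set Implicit Arguments.
Unset Strict Implicit.
Unset Printing Implicit Defensive.

Import Order.TTheory GRing.Theory Num.Theory.

Local Open Scope classical_set_scope.
Local Open Scope ring_scope.

Definition layer (R : Type) : Type := 'M[R]_4 * 'M[R]_4 * 'M[R]_4.
Definition layers (R : Type) : Type := {ffun 'I_48 -> layer R}.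

Definition U_ (R : Type) (s : layers R) (i : 'I_48) : 'M[R]_4 := (s i).1.1.
Definition V_ (R : Type) (s : layers R) (i : 'I_48) : 'M[R]_4 := (s i).1.2.
Definition W_ (R : Type) (s : layers R) (i : 'I_48) : 'M[R]_4 := (s i).2.

Section Algorithms.
Variable R : realType.

(* (R^{4x4})^{(x)3} is identified with R^{64x64} through the Kronecker product
   [*t], which sends the basis e_ab (x) e_cd (x) e_ef to the 4^6 matrix units. *)
Definition tensor3 (U V W : 'M[R]_4) : 'M[R]_(4 * 4 * 4) := U *t V *t W.

Definition mm_tensor : 'M[R]_(4 * 4 * 4) :=
  \sum_(i < 4) \sum_(j < 4) \sum_(k < 4)
     tensor3 (delta_mx i j) (delta_mx j k) (delta_mx k i).

Definition algorithms : set (layers R) :=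
  [set s | \sum_(i < 48) tensor3 (U_ s i) (V_ s i) (W_ s i) = mm_tensor].

Definition de_groote (A B C : 'M[R]_4) (s : layers R) : layers R :=
  [ffun i => (A *m U_ s i *m invmx B,
              B *m V_ s i *m invmx C,
              C *m W_ s i *m invmx A)].

Definition layer_scaling (l m : 'I_48 -> R) (s : layers R) : layers R :=
  [ffun i => (l i *: U_ s i, m i *: V_ s i, (l i * m i)^-1 *: W_ s i)].

Definition layer_perm (p : 'S_48) (s : layers R) : layers R :=
  [ffun i => s (p i)].

Definition cyclic_shift (s : layers R) : layers R :=
  [ffun i => (W_ s i, U_ s i, V_ s i)].

Definition transposition (s : layers R) : layers R :=
  [ffun i => ((U_ s i)^T, (W_ s i)^T, (V_ s i)^T)].

Inductive isotropy_generator : (layers R -> layers R) -> Prop :=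
| gen_de_groote A B C : A \in unitmx -> B \in unitmx -> C \in unitmx ->
    isotropy_generator (de_groote A B C)
| gen_scaling l m : (forall i, l i != 0) -> (forall i, m i != 0) ->
    isotropy_generator (layer_scaling l m)
| gen_perm p : isotropy_generator (layer_perm p)
| gen_cyclic : isotropy_generator cyclic_shift
| gen_transposition : isotropy_generator transposition.

(* The subgroup of the symmetric group of [algorithms] generated by the
   restrictions of the generators; each generator does restrict to [algorithms]
   by [isotropy_generator_stable] below. *)
Inductive isotropy : (algorithms -> algorithms) -> Prop :=
| isotropy_gen f (g : algorithms -> algorithms) : isotropy_generator f ->
    (forall x, val (g x) = f (val x)) -> isotropy g
| isotropy_id : isotropy id
| isotropy_comp g h : isotropy g -> isotropy h -> isotropy (g \o h)
| isotropy_inv g h : isotropy g -> cancel g h -> cancel h g -> isotropy h.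

(* The orbit of a point of [algorithms], as a subset of [layers R]; it is only
   meaningful (and nonempty) when [algorithms s] holds. *)
Definition isotropy_orbit (s : layers R) : set (layers R) :=
  [set s' | exists2 g, isotropy g &
            exists2 x : algorithms, val x = s & val (g x) = s'].

Definition rationals : set R := range (ratr : rat -> R).

Definition rational_coefficients (s : layers R) : Prop :=
  forall i a b,
    [/\ rationals (U_ s i a b), rationals (V_ s i a b)
      & rationals (W_ s i a b)].

Definition mx4 (r0 r1 r2 r3 : seq R) : 'M[R]_4 :=
  \matrix_(i, j) nth 0 (nth [::] [:: r0; r1; r2; r3] i) j.

Local Notation z := [:: 0; 0; 0; 0].

Definition family_seq (t : R) : seq (layer R) :=
  [::
   (mx4 [:: -1; 1; 1; 1] [:: -1; 1; 1; 1] [:: 1; -1; -1; -1] [:: -1; 1; 1; 1],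
    mx4 z z [:: 1; 0; 0; 0] [:: 1; 0; 0; 0],
    4^-1 *: mx4 [:: 0; 0; -1; 1] [:: 0; 0; 1; -1] [:: 0; 0; 1 - 4 * t; 4 * t - 1] [:: 0; 0; -1; 1]);
   (mx4 [:: -1; 0; 0; 0] [:: 1; 0; 0; 0] [:: 1; 0; 0; 0] [:: -1; 0; 0; 0],
    mx4 [:: 0; 1; 0; 1] [:: 0; -1; 0; -1] z z,
    (8 * t)^-1 *: mx4 [:: -1; 1; 0; 0] z z [:: -4 * t; 4 * t; 0; 0]);
   (mx4 [:: 0; 0; -1; 0] [:: 0; 0; 1; 0] [:: 0; 0; 1; 0] [:: 0; 0; 1; 0],
    mx4 [:: 0; 1; 0; 0] z [:: 0; 1; 0; 0] z,
    2^-1 *: mx4 z [:: 0; 1; 0; 1] [:: 0; -4 * t; 0; -4 * t] [:: 0; 4 * t - 1; 0; 4 * t - 1]);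
   (mx4 [:: 0; 0; -1; -1] [:: 0; 0; -1; -1] [:: 0; 0; 1; -1] [:: 0; 0; 1; -1],
    4^-1 *: mx4 z z [:: 0; 4 * t; 1; 0] [:: 4 * t; 0; -1; 0],
    (2 * t)^-1 *: mx4 z [:: -1; -1; 0; 0] [:: 2 * t; 2 * t; 2 * t; 2 * t] [:: 1 - 2 * t; 1 - 2 * t; -2 * t; -2 * t]);
   (mx4 [:: 1; 1; 1; -1] [:: -1; -1; -1; 1] [:: 1; 1; 1; -1] [:: 1; 1; 1; -1],
    mx4 [:: -4 * t; 0; 1; 1] [:: -4 * t; 0; 1; 1] z z,
    4^-1 *: mx4 z z z [:: 0; 0; 1; 1]);
   (mx4 [:: 1; 1; -1; 1] [:: -1; -1; 1; -1] [:: -1; -1; 1; -1] [:: 1; 1; -1; 1],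
    mx4 z [:: 0; 1; 0; 1] z [:: 0; 1; 0; 1],
    4^-1 *: mx4 [:: 0; 1; 0; -1] [:: 0; -1; 0; 1] [:: 0; 4 * t; 0; -4 * t] z);
   (mx4 [:: 0; 0; 0; -1] [:: 0; 0; 0; 1] [:: 0; 0; 0; 1] [:: 0; 0; 0; 1],
    mx4 z [:: 0; 1; 0; 0] z [:: 0; -1; 0; 0],
    2^-1 *: mx4 z [:: 1; 0; -1; 0] z [:: -1; 0; 1; 0]);
   (mx4 [:: 1; 1; 1; -1] [:: -1; -1; -1; 1] [:: 1; 1; 1; -1] [:: -1; -1; -1; 1],
    mx4 [:: 4 * t; 4 * t - 1; 0; -1] z [:: 4 * t; 4 * t - 1; 0; -1] z,
    4^-1 *: mx4 z z z [:: 0; 1; 0; 1]);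
   (mx4 [:: 0; 0; -1; -1] [:: 0; 0; 1; 1] [:: -1; 1; 0; 0] [:: -1; 1; 0; 0],
    mx4 [:: 4 * t; 1; -1; -1] [:: -4 * t; -1; 1; 1] [:: -4 * t; 1; 1; 1] [:: -4 * t; 1; 1; 1],
    8^-1 *: mx4 [:: 1; -1; 1; 1] [:: -1; 1; -1; -1] [:: 4 * t - 2; 2 - 4 * t; 4 * t; 4 * t] [:: 1; -1; 1; 1]);
   (mx4 [:: 1; 0; 0; 0] [:: 1; 0; 0; 0] [:: 1; 0; 0; 0] [:: -1; 0; 0; 0],
    mx4 [:: 1 - 4 * t; 1; 1; 1] z [:: 4 * t - 1; -1; -1; -1] z,
    2^-1 *: mx4 [:: 1; 0; 1; 0] z z [:: 4 * t; 0; 4 * t; 0]);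
   (mx4 [:: -1; -1; -1; 1] [:: 1; 1; 1; -1] [:: 1; 1; 1; -1] [:: -1; -1; -1; 1],
    mx4 z [:: 0; 1; 0; 1] z [:: 0; -1; 0; -1],
    4^-1 *: mx4 z z z [:: -1; 0; 1; 0]);
   (mx4 [:: 0; 1; 0; 1] [:: -1; 0; 1; 0] [:: 0; 1; 0; 1] [:: -1; 0; 1; 0],
    mx4 [:: -4 * t; 1 - 8 * t; -1; 1] [:: 4 * t; -1; -1; -1] [:: 4 * t; 8 * t - 1; 1; -1] [:: 4 * t; -1; -1; -1],
    8^-1 *: mx4 [:: 2; 0; 2; 0] [:: -2; 0; -2; 0] [:: 8 * t - 1; 1; 8 * t - 1; 1] [:: 1; -1; 1; -1]);
   (mx4 [:: 0; 0; 1; 0] [:: 0; 0; -1; 0] [:: 0; 0; 1; 0] [:: 0; 0; 1; 0],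
    mx4 [:: 4 * t; 0; -1; -1] z [:: -4 * t; 0; 1; 1] z,
    2^-1 *: mx4 z [:: -1; 0; -1; 0] [:: 4 * t; 0; 4 * t; 0] [:: 1 - 4 * t; 0; 1 - 4 * t; 0]);
   (mx4 [:: 0; 0; 1; 0] [:: 0; 0; 1; 0] [:: 0; 0; -1; 0] [:: 0; 0; -1; 0],
    mx4 z z [:: 4 * t; 0; -1; 0] [:: -4 * t; 0; 1; 0],
    (8 * t)^-1 *: mx4 z [:: 1; 1; 0; 0] [:: -4 * t; -4 * t; 0; 0] [:: 4 * t - 1; 4 * t - 1; 0; 0]);
   (mx4 [:: 1; 0; 1; 0] [:: 1; 0; -1; 0] [:: -1; 0; -1; 0] [:: 1; 0; -1; 0],
    mx4 [:: 0; 1; 0; 0] z [:: -1; 0; 0; 0] z,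
    4^-1 *: mx4 [:: -1; 1; 1; 1] [:: 1; 1; -1; 1] [:: -4 * t; -4 * t; 4 * t; -4 * t] [:: -1; 8 * t - 1; 1; 8 * t - 1]);
   (mx4 [:: 1; 1; -1; 1] [:: -1; -1; 1; -1] [:: 1; 1; -1; 1] [:: -1; -1; 1; -1],
    mx4 [:: 4 * t; 4 * t - 1; 0; -1] z [:: -4 * t; 1 - 4 * t; 0; 1] z,
    4^-1 *: mx4 [:: 1; 0; 1; 0] [:: -1; 0; -1; 0] [:: 4 * t; 0; 4 * t; 0] z);
   (mx4 [:: 1; 1; 0; 0] [:: 1; 1; 0; 0] [:: -1; 1; 0; 0] [:: -1; 1; 0; 0],
    mx4 [:: 0; -4 * t; -1; 0] [:: 4 * t; 0; -1; 0] z z,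
    (8 * t)^-1 *: mx4 [:: 0; 0; 1; 1] z [:: -2 * t; -2 * t; 2 * t; 2 * t] [:: 2 * t; 2 * t; 2 * t; 2 * t]);
   (mx4 [:: -1; 1; 1; 1] [:: -1; 1; 1; 1] [:: 1; -1; -1; -1] [:: 1; -1; -1; -1],
    mx4 z [:: 4 * t; 0; -1; 0] z [:: 4 * t; 0; -1; 0],
    4^-1 *: mx4 [:: 0; 1; 0; -1] [:: 0; -1; 0; 1] [:: 0; 4 * t - 1; 0; 1 - 4 * t] [:: 0; 1; 0; -1]);
   (mx4 [:: 0; 1; 0; 1] [:: -1; 0; 1; 0] [:: 0; -1; 0; -1] [:: 1; 0; -1; 0],
    mx4 [:: 4 * t; -1; -1; -1] [:: 4 * t; 1; -1; 1] [:: -4 * t; 1; 1; 1] [:: 4 * t; 1; -1; 1],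
    8^-1 *: mx4 [:: 0; -2; 0; 2] [:: 0; 2; 0; -2] [:: -1; 1 - 8 * t; 1; 8 * t - 1] [:: 1; -1; -1; 1]);
   (mx4 [:: -1; 1; -1; -1] [:: -1; 1; -1; -1] [:: 1; -1; 1; 1] [:: 1; -1; 1; 1],
    mx4 z [:: -4 * t; 0; 1; 0] z [:: 4 * t; 0; -1; 0],
    4^-1 *: mx4 z z [:: 1; 0; -1; 0] z);
   (mx4 [:: 0; 0; 1; 0] [:: 0; 0; -1; 0] [:: 0; 0; -1; 0] [:: 0; 0; 1; 0],
    mx4 z z [:: 0; 1; 0; 1] [:: 0; 1; 0; 1],
    (8 * t)^-1 *: mx4 z [:: 0; 0; -1; 1] [:: 0; 0; 4 * t; -4 * t] [:: 0; 0; 1 - 4 * t; 4 * t - 1]);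
   (mx4 [:: 1; 0; 1; 0] [:: 0; -1; 0; 1] [:: 1; 0; 1; 0] [:: 0; -1; 0; 1],
    mx4 [:: 4 * t; 8 * t - 1; 1; -1] [:: -4 * t; 1; 1; 1] [:: 4 * t; 8 * t - 1; 1; -1] [:: 4 * t; -1; -1; -1],
    8^-1 *: mx4 z z [:: 1; -1; 1; -1] [:: -1; -1; -1; -1]);
   (mx4 [:: 0; 0; 0; 1] [:: 0; 0; 0; -1] [:: 0; 0; 0; 1] [:: 0; 0; 0; 1],
    mx4 z [:: -4 * t; 0; 1; 1] z [:: -4 * t; 0; 1; 1],
    2^-1 *: mx4 z [:: 0; 1; 0; -1] z [:: 0; -1; 0; 1]);
   (mx4 [:: 1; -1; 1; 1] [:: -1; 1; -1; -1] [:: 1; -1; 1; 1] [:: 1; -1; 1; 1],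
    mx4 [:: 4 * t; 0; -1; -1] [:: -4 * t; 0; 1; 1] z z,
    4^-1 *: mx4 z z [:: -1; 1; 0; 0] z);
   (mx4 [:: 1; 1; 0; 0] [:: -1; -1; 0; 0] [:: 0; 0; 1; -1] [:: 0; 0; 1; -1],
    mx4 [:: 4 * t; 1; -1; -1] [:: 4 * t; 1; -1; -1] [:: -4 * t; 1; 1; 1] [:: 4 * t; -1; -1; -1],
    8^-1 *: mx4 [:: -1; 1; -1; -1] [:: 1; -1; 1; 1] [:: -4 * t; 4 * t; -4 * t; -4 * t] [:: -1; 1; 1; 1]);
   (mx4 [:: 1; -1; 1; 1] [:: 1; -1; 1; 1] [:: 1; -1; 1; 1] [:: -1; 1; -1; -1],
    mx4 z z [:: 1 - 4 * t; 1; 1; 1] [:: 1 - 4 * t; 1; 1; 1],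
    4^-1 *: mx4 z z [:: 0; 0; 1; -1] z);
   (mx4 [:: 0; 1; 0; 0] [:: 0; 1; 0; 0] [:: 0; 1; 0; 0] [:: 0; 1; 0; 0],
    (4 * t)^-1 *: mx4 [:: 0; 4 * t; 1; 0] [:: 0; 4 * t; 1; 0] z z,
    2^-1 *: mx4 [:: 0; 0; 1; 1] z [:: 0; 0; 4 * t; 4 * t] z);
   (mx4 [:: 0; 0; 1; 1] [:: 0; 0; 1; 1] [:: 1; -1; 0; 0] [:: -1; 1; 0; 0],
    mx4 [:: 4 * t; -1; -1; -1] [:: -4 * t; 1; 1; 1] [:: 2 - 4 * t; 1; 1; 1] [:: 2 - 4 * t; 1; 1; 1],
    8^-1 *: mx4 [:: 1; 1; 1; -1] [:: -1; -1; -1; 1] [:: 4 * t; 4 * t; 4 * t - 2; 2 - 4 * t] [:: 1; 1; 1; -1]);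
   (mx4 [:: 1; -1; -1; -1] [:: -1; 1; 1; 1] [:: -1; 1; 1; 1] [:: -1; 1; 1; 1],
    mx4 [:: 0; -1; 0; 0] [:: 0; 1; 0; 0] z z,
    4^-1 *: mx4 [:: 1; -1; 0; 0] [:: -1; 1; 0; 0] [:: 4 * t - 1; 1 - 4 * t; 0; 0] [:: 1; -1; 0; 0]);
   (mx4 [:: 0; 0; 0; 1] [:: 0; 0; 0; 1] [:: 0; 0; 0; 1] [:: 0; 0; 0; 1],
    (4 * t)^-1 *: mx4 z z [:: 0; -4 * t; -1; 0] [:: 0; 4 * t; 1; 0],
    2^-1 *: mx4 z [:: 1; 1; 0; 0] z [:: -1; -1; 0; 0]);
   (mx4 [:: 0; 1; 0; 0] [:: 0; -1; 0; 0] [:: 0; 1; 0; 0] [:: 0; -1; 0; 0],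
    (4 * t)^-1 *: mx4 [:: 4 * t; 4 * t - 1; 0; -1] [:: -4 * t; 1 - 4 * t; 0; 1] z z,
    2^-1 *: mx4 [:: -1; 1; 0; 0] z [:: -4 * t; 4 * t; 0; 0] z);
   (mx4 [:: 1; 0; 1; 0] [:: 0; -1; 0; 1] [:: -1; 0; -1; 0] [:: 0; 1; 0; -1],
    mx4 [:: 4 * t; -1; -1; -1] [:: 4 * t; 1; -1; 1] [:: 4 * t; -1; -1; -1] [:: -4 * t; -1; 1; -1],
    8^-1 *: mx4 z z [:: -1; 1; 1; -1] [:: -1; -1; 1; 1]);
   (mx4 [:: -1; -1; 1; -1] [:: 1; 1; -1; 1] [:: 1; 1; -1; 1] [:: 1; 1; -1; 1],
    mx4 [:: 0; -1; 0; 0] [:: 0; -1; 0; 0] z z,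
    4^-1 *: mx4 [:: 0; 0; 1; 1] [:: 0; 0; -1; -1] [:: 0; 0; 4 * t; 4 * t] z);
   (mx4 [:: 0; 0; -1; -1] [:: 0; 0; 1; 1] [:: 0; 0; 1; -1] [:: 0; 0; -1; 1],
    mx4 z z [:: -4 * t; 1 - 4 * t; 0; 1] [:: 0; 1; 0; 1],
    (8 * t)^-1 *: mx4 z [:: 0; 0; -1; 1] [:: 2 * t; -2 * t; 2 * t; -2 * t] [:: -2 * t; 2 * t; 1 - 2 * t; 2 * t - 1]);
   (mx4 [:: 1; 1; 0; 0] [:: 1; 1; 0; 0] [:: 0; 0; 1; -1] [:: 0; 0; -1; 1],
    mx4 [:: -4 * t; 1; 1; 1] [:: -4 * t; 1; 1; 1] [:: 4 * t - 2; -1; -1; -1] [:: 2 - 4 * t; 1; 1; 1],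
    8^-1 *: mx4 [:: -1; -1; -1; 1] [:: 1; 1; 1; -1] [:: -4 * t; -4 * t; -4 * t; 4 * t] [:: 1; 1; -1; 1]);
   (mx4 [:: 1; -1; 1; 1] [:: 1; -1; 1; 1] [:: 1; -1; 1; 1] [:: 1; -1; 1; 1],
    mx4 [:: 0; 4 * t; 1; 0] z [:: 0; 4 * t; 1; 0] z,
    4^-1 *: mx4 z z [:: 0; 1; 0; 1] z);
   (mx4 [:: 0; 1; 0; 0] [:: 0; 1; 0; 0] [:: 0; 1; 0; 0] [:: 0; -1; 0; 0],
    mx4 z [:: 1 - 4 * t; 1; 1; 1] z [:: 1 - 4 * t; 1; 1; 1],
    2^-1 *: mx4 [:: 0; 1; 0; -1] z [:: 0; 4 * t; 0; -4 * t] z);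
   (mx4 [:: 0; 1; 0; 1] [:: 0; 1; 0; -1] [:: 0; 1; 0; 1] [:: 0; -1; 0; 1],
    mx4 z [:: -4 * t; 0; 1; 1] z [:: 1 - 4 * t; 1; 1; 1],
    4^-1 *: mx4 [:: 1; -1; 1; 1] [:: -1; -1; -1; 1] [:: 4 * t; -4 * t; 4 * t; 4 * t] [:: 1; 1; 1; -1]);
   (mx4 [:: 0; 1; 0; 0] [:: 0; 1; 0; 0] [:: 0; -1; 0; 0] [:: 0; 1; 0; 0],
    mx4 z [:: -1; 0; 0; 0] z [:: 1; 0; 0; 0],
    2^-1 *: mx4 [:: -1; 0; 1; 0] z [:: -4 * t; 0; 4 * t; 0] z);
   (mx4 [:: -1; -1; 0; 0] [:: 1; 1; 0; 0] [:: 1; -1; 0; 0] [:: -1; 1; 0; 0],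
    mx4 [:: 4 * t; 4 * t - 1; 0; -1] [:: 0; 1; 0; 1] z z,
    (8 * t)^-1 *: mx4 [:: -1; 1; 0; 0] z [:: -2 * t; 2 * t; 2 * t; -2 * t] [:: -2 * t; 2 * t; -2 * t; 2 * t]);
   (mx4 [:: -1; 1; 1; 1] [:: -1; 1; 1; 1] [:: -1; 1; 1; 1] [:: -1; 1; 1; 1],
    mx4 [:: 0; 4 * t; 1; 0] z [:: 0; -4 * t; -1; 0] z,
    4^-1 *: mx4 [:: 1; 0; 1; 0] [:: -1; 0; -1; 0] [:: 4 * t - 1; 0; 4 * t - 1; 0] [:: 1; 0; 1; 0]);
   (mx4 [:: 0; 0; 0; 1] [:: 0; 0; 0; -1] [:: 0; 0; 0; 1] [:: 0; 0; 0; -1],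
    (4 * t)^-1 *: mx4 z z [:: 4 * t; 4 * t - 1; 0; -1] [:: 4 * t; 4 * t - 1; 0; -1],
    2^-1 *: mx4 z [:: 0; 0; 1; -1] z [:: 0; 0; -1; 1]);
   (mx4 [:: 1; 0; 0; 0] [:: 1; 0; 0; 0] [:: -1; 0; 0; 0] [:: 1; 0; 0; 0],
    mx4 [:: 1; 0; 0; 0] z [:: 1; 0; 0; 0] z,
    2^-1 *: mx4 [:: 0; 1; 0; 1] z z [:: 0; 4 * t; 0; 4 * t]);
   (mx4 [:: 1; 0; 1; 0] [:: 1; 0; -1; 0] [:: 1; 0; 1; 0] [:: -1; 0; 1; 0],
    mx4 [:: 4 * t; 0; -1; -1] z [:: 1 - 4 * t; 1; 1; 1] z,
    4^-1 *: mx4 [:: 1; -1; 1; 1] [:: 1; 1; 1; -1] [:: -4 * t; -4 * t; -4 * t; 4 * t] [:: 8 * t - 1; -1; 8 * t - 1; 1]);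
   (mx4 [:: 1; 1; -1; 1] [:: 1; 1; -1; 1] [:: -1; -1; 1; -1] [:: 1; 1; -1; 1],
    mx4 z z [:: -1; 0; 0; 0] [:: 1; 0; 0; 0],
    4^-1 *: mx4 [:: 1; 1; 0; 0] [:: -1; -1; 0; 0] [:: 4 * t; 4 * t; 0; 0] z);
   (mx4 [:: 1; 1; 1; -1] [:: 1; 1; 1; -1] [:: 1; 1; 1; -1] [:: -1; -1; -1; 1],
    mx4 z z [:: 1 - 4 * t; 1; 1; 1] [:: 4 * t - 1; -1; -1; -1],
    4^-1 *: mx4 z z z [:: 1; 1; 0; 0]);
   (mx4 [:: -1; 0; 0; 0] [:: -1; 0; 0; 0] [:: 1; 0; 0; 0] [:: 1; 0; 0; 0],
    (4 * t)^-1 *: mx4 [:: 4 * t; 0; -1; 0] [:: 4 * t; 0; -1; 0] z z,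
    2^-1 *: mx4 [:: 0; 0; 1; 1] z z [:: 0; 0; 4 * t; 4 * t]);
   (mx4 [:: 0; -1; 0; -1] [:: 0; -1; 0; 1] [:: 0; 1; 0; 1] [:: 0; -1; 0; 1],
    mx4 z [:: 0; 1; 0; 0] z [:: 1; 0; 0; 0],
    4^-1 *: mx4 [:: -1; 1; 1; 1] [:: -1; -1; 1; -1] [:: -4 * t; 4 * t; 4 * t; 4 * t] [:: 1; 1; -1; 1])].

Definition mm48_family (t : R) : layers R :=
  [ffun i : 'I_48 => nth (0, 0, 0) (family_seq t) i].

Lemma size_family_seq t : size (family_seq t) = 48%N.
Proof. by []. Qed.


Lemma tensor3E (U V W : 'M[R]_4) a b c d e f :
  tensor3 U V W (mxtens_index (mxtens_index (a, c), e))
                (mxtens_index (mxtens_index (b, d), f)) =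
  U a b * V c d * W e f.
Proof. by rewrite /tensor3 !tensmxE. Qed.

Lemma mm_tensorE a b c d e f :
  mm_tensor (mxtens_index (mxtens_index (a, c), e))
            (mxtens_index (mxtens_index (b, d), f)) =
  [&& b == c, d == e & f == a]%:R.
Proof.
rewrite /mm_tensor summxE (bigD1 a) //= [X in _ + X]big1 ?addr0; last first.
  move=> i ia; rewrite summxE big1 // => j _; rewrite summxE big1 // => k _.
  by rewrite tensor3E !mxE eq_sym (negbTE ia) !mul0r.
rewrite summxE (bigD1 b) //= [X in _ + X]big1 ?addr0; last first.
  move=> j jb; rewrite summxE big1 // => k _.
  by rewrite tensor3E !mxE eq_sym (negbTE jb) andbF !mul0r.
rewrite summxE (bigD1 d) //= [X in _ + X]big1 ?addr0; last first.
  move=> k kd.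
  by rewrite tensor3E !mxE [d == k]eq_sym (negbTE kd) andbF mulr0 mul0r.
rewrite tensor3E !mxE !eqxx andbT mul1r -natrM mulnb.
rewrite [c == b]eq_sym [e == d]eq_sym.
by do ![case: eqP => //= _].
Qed.

Lemma algorithmsP s : algorithms s <->
  forall a b c d e f, \sum_(i < 48) U_ s i a b * V_ s i c d * W_ s i e f =
                      [&& b == c, d == e & f == a]%:R.
Proof.
rewrite /algorithms /=; split=> [E a b c d e f|E].
  rewrite -mm_tensorE -E summxE; apply: eq_bigr => i _; by rewrite tensor3E.
apply/matrixP=> i j.
case: (mxtens_indexP i)=> i' e; case: (mxtens_indexP i')=> a c.
case: (mxtens_indexP j)=> j' f; case: (mxtens_indexP j')=> b d.
rewrite mm_tensorE -E summxE; apply: eq_bigr => k _; by rewrite tensor3E.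
Qed.

Lemma mm_tensor_de_groote (A B C : 'M[R]_4) :
  tensor3 A B C *m mm_tensor = mm_tensor *m tensor3 B C A.
Proof.
apply/matrixP=> i j.
case: (mxtens_indexP i)=> i' e; case: (mxtens_indexP i')=> a c.
case: (mxtens_indexP j)=> j' f; case: (mxtens_indexP j')=> b d.
rewrite !mxE.
rewrite (bigD1 (mxtens_index (mxtens_index (f, b), d))) //= big1 ?addr0;
  last first.
  move=> k; case: (mxtens_indexP k)=> k' z'; case: (mxtens_indexP k')=> x y.
  rewrite mm_tensorE; case: and3P => [[/eqP -> /eqP -> /eqP ->]|_ _].
    by rewrite eqxx.
  by rewrite mulr0.
rewrite (bigD1 (mxtens_index (mxtens_index (c, e), a))) //= big1 ?addr0;
  last first.
  move=> k; case: (mxtens_indexP k)=> k' z'; case: (mxtens_indexP k')=> x y.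
  rewrite mm_tensorE; case: and3P => [[/eqP -> /eqP -> /eqP ->]|_ _].
    by rewrite eqxx.
  by rewrite mul0r.
by rewrite !mm_tensorE !tensor3E !eqxx mulr1 mul1r -mulrA mulrC.
Qed.

Lemma isotropy_generator_stable f s :
  isotropy_generator f -> algorithms s -> algorithms (f s).
Proof.
case=> {f} [A B C uA uB uC|l m l0 m0|p||].
- rewrite /algorithms /= => E.
  have mul3 (X Y Z X' Y' Z' : 'M[R]_4) :
      tensor3 X Y Z *m tensor3 X' Y' Z' =
      tensor3 (X *m X') (Y *m Y') (Z *m Z') by rewrite /tensor3 !tensmx_mul.
  have inv3 : tensor3 B C A *m tensor3 (invmx B) (invmx C) (invmx A) = 1%:M.
    rewrite mul3 !mulmxV //; apply/matrixP=> i j.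
    case: (mxtens_indexP i)=> i' e; case: (mxtens_indexP i')=> a c.
    case: (mxtens_indexP j)=> j' f; case: (mxtens_indexP j')=> b d.
    rewrite tensor3E !mxE -!natrM !mulnb.
    rewrite (can_eq (@mxtens_indexK _ _)) xpair_eqE.
    by rewrite (can_eq (@mxtens_indexK _ _)) xpair_eqE.
  transitivity (tensor3 A B C *m mm_tensor *m
                tensor3 (invmx B) (invmx C) (invmx A)); last first.
    by rewrite mm_tensor_de_groote -mulmxA inv3 mulmx1.
  rewrite -E mulmx_sumr mulmx_suml; apply: eq_bigr => i _.
  by rewrite !mul3 /U_ /V_ /W_ ffunE.
- move=> /algorithmsP E; apply/algorithmsP=> a b c d e f; rewrite -E.
  apply: eq_bigr => i _; rewrite /U_ /V_ /W_ ffunE /= !mxE.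
  by rewrite (mulrACA (l i)) (mulrACA (l i * m i)) divff ?mulf_neq0 // mul1r.
- move=> /algorithmsP E; apply/algorithmsP=> a b c d e f; rewrite -E.
  rewrite [RHS](reindex_inj (@perm_inj _ p)).
  by apply: eq_bigr => i _; rewrite /U_ /V_ /W_ ffunE.
- move=> /algorithmsP E; apply/algorithmsP=> a b c d e f.
  transitivity ([&& d == e, f == a & b == c]%:R : R).
    rewrite -E; apply: eq_bigr => i _; rewrite /U_ /V_ /W_ ffunE /=.
    by rewrite -mulrA mulrC.
  by rewrite andbA andbC.
- move=> /algorithmsP E; apply/algorithmsP=> a b c d e f.
  transitivity ([&& a == f, e == d & c == b]%:R : R).
    rewrite -E; apply: eq_bigr => i _; rewrite /U_ /V_ /W_ ffunE /= !mxE.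
    by rewrite mulrAC.
  rewrite [a == f]eq_sym [e == d]eq_sym [c == b]eq_sym.
  by congr (nat_of_bool _)%:R; do ![case: eqP].
Qed.

End Algorithms.

(* Main.v *)
(** Both the tensor identity and the separation of orbits are polynomial
identities in [t] once every matrix of the family is multiplied by [8 t], which
clears all denominators; they are checked by computing with coefficient lists.

Orbits are separated by the sum, over all pairs of layers [(i, j)] and the three
cyclic rotations, of [(tr (U_i V_i W_i U_j V_j W_j))^2]. De Groote actions
conjugate the products [U_i V_i W_i], layer scalings fix them, transposition
transposes and exchanges the rotations, so the sum is invariant. On the family it
equals [3328 + 512 t^2 + 2 / t^2]; two parameters with the same value satisfy
[t1 = +- t2] or [t1 t2 = +- 1/16], and inside one of the four intervals this
forces [t1 = t2]. *)

From Stdlib Require Import ZArith.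
Require Import Defs.
From mathcomp Require Import all_boot all_order all_algebra all_fingroup.
From mathcomp Require Import ssrZ zify ring lra.
From mathcomp Require Import all_classical all_reals.

Set Implicit Arguments.
Unset Strict Implicit.
Unset Printing Implicit Defensive.

Import Order.TTheory GRing.Theory Num.Theory.

Local Open Scope classical_set_scope.
Local Open Scope ring_scope.

(** * Integer polynomials as coefficient lists *)

Definition zpoly := seq Z.

Fixpoint zp_add (p q : zpoly) : zpoly :=
  match p, q with
  | [::], _ => q
  | _, [::] => p
  | a :: p', b :: q' => Z.add a b :: zp_add p' q'
  end.

Definition zp_scale (a : Z) (p : zpoly) : zpoly := map (Z.mul a) p.

(** Zero coefficients of [p] are skipped and an empty product is not shifted, so sparse products
    stay cheap to compute. *)
Fixpoint zp_mul (p q : zpoly) : zpoly :=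
  match p, q with
  | [::], _ => [::]
  | _, [::] => [::]
  | a :: p', _ =>
      let r := zp_mul p' q in
      let r := if r is [::] then [::] else Z0 :: r in
      if a is Z0 then r else zp_add (zp_scale a q) r
  end.

Definition zp_sum (s : seq zpoly) : zpoly := foldr zp_add [::] s.

(** Equality up to trailing zeros, since the operations do not normalize their results. *)
Fixpoint zp_eqb (p q : zpoly) : bool :=
  match p, q with
  | [::], _ => all (pred1 Z0) q
  | _, [::] => all (pred1 Z0) p
  | a :: p', b :: q' => (a == b) && zp_eqb p' q'
  end.

Section ZPolyEval.
Variables (R : comPzRingType) (t : R).

Definition Zr (a : Z) : R := (int_of_Z a)%:~R.

Definition zp_eval (p : zpoly) : R := foldr (fun a r => Zr a + t * r) 0 p.

Lemma ZrD a b : Zr (Z.add a b) = Zr a + Zr b.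
Proof. by rewrite /Zr -intrD -[Z.add a b]/(a + b) rmorphD. Qed.

Lemma ZrM a b : Zr (Z.mul a b) = Zr a * Zr b.
Proof. by rewrite /Zr -intrM -[Z.mul a b]/(a * b) rmorphM. Qed.

Lemma zp_evalD p q : zp_eval (zp_add p q) = zp_eval p + zp_eval q.
Proof.
elim: p q => [|a p IH] [|b q] /=; rewrite ?add0r ?addr0 //.
by rewrite IH ZrD; ring.
Qed.

Lemma zp_evalZ a p : zp_eval (zp_scale a p) = Zr a * zp_eval p.
Proof. by elim: p => [|b p IH] /=; rewrite ?mulr0 // IH ZrM; ring. Qed.

Lemma zp_evalM p q : zp_eval (zp_mul p q) = zp_eval p * zp_eval q.
Proof.
elim: p => [|a p IH]; first by rewrite mul0r.
case: q IH => [|b q] IH; first by rewrite mulr0.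
set u := b :: q in IH *.
set r := if zp_mul p u is [::] then [::] else Z0 :: zp_mul p u.
have Er : zp_eval r = t * (zp_eval p * zp_eval u).
  by rewrite -IH /r; case: (zp_mul p u) => [|c v] /=; rewrite ?mulr0 // add0r.
have -> : zp_mul (a :: p) u = if a is Z0 then r else zp_add (zp_scale a u) r.
  by [].
rewrite [zp_eval (a :: p)]/= mulrDl -mulrA -Er.
by case: a => [|a|a]; rewrite ?zp_evalD ?zp_evalZ // mul0r add0r.
Qed.

Lemma zp_eval_sum (I : Type) (f : I -> zpoly) s :
  zp_eval (zp_sum (map f s)) = \sum_(i <- s) zp_eval (f i).
Proof.
by elim: s => [|i s IH] /=; rewrite ?big_nil // big_cons zp_evalD IH.
Qed.

Lemma zp_eval_sum_iota (f : nat -> zpoly) n :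
  zp_eval (zp_sum (map f (iota 0 n))) = \sum_(i < n) zp_eval (f i).
Proof. by rewrite zp_eval_sum -(big_mkord xpredT (zp_eval \o f)) /index_iota subn0. Qed.

Lemma zp_eval_eqb p q : zp_eqb p q -> zp_eval p = zp_eval q.
Proof.
have null r : all (pred1 Z0) r -> zp_eval r = 0.
  by elim: r => //= c r IH /andP[/eqP -> /IH ->]; rewrite mulr0 addr0.
elim: p q => [|a p IH] [|b q] //=.
- by move=> /(null (b :: q)) /= ->.
- by move=> /(null (a :: p)) /= ->.
- by case/andP=> /eqP -> /IH ->.
Qed.

End ZPolyEval.

(** * Matrices of integer polynomials *)

Definition zpmx := seq (seq zpoly).
Definition zpmx_ent (M : zpmx) a b : zpoly := nth [::] (nth [::] M a) b.
Definition zpmx_mul (M N : zpmx) : zpmx :=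
  mkseq (fun a => mkseq (fun b =>
    zp_sum [seq zp_mul (zpmx_ent M a k) (zpmx_ent N k b) | k <- iota 0 4]) 4) 4.
Definition zpmx_trmul (M N : zpmx) : zpoly :=
  zp_sum [seq zp_sum [seq zp_mul (zpmx_ent M a k) (zpmx_ent N k a)
                     | k <- iota 0 4] | a <- iota 0 4].

Section ZPMatrix.
Variables (R : comPzRingType) (t : R).

(** The factor [c] clears the denominators of [A]; such factors multiply along matrix products. *)
Definition zpmx_repr (c : R) (M : zpmx) (A : 'M[R]_4) :=
  forall a b : 'I_4, zp_eval t (zpmx_ent M a b) = c * A a b.

Lemma zpmx_repr_mul c d M N A B : zpmx_repr c M A -> zpmx_repr d N B ->
  zpmx_repr (c * d) (zpmx_mul M N) (A *m B).
Proof.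
move=> MA NB a b; rewrite /zpmx_ent !nth_mkseq // zp_eval_sum_iota mxE mulr_sumr.
by apply: eq_bigr => k _; rewrite zp_evalM MA NB mulrACA.
Qed.

Lemma zp_eval_trmul c d M N A B : zpmx_repr c M A -> zpmx_repr d N B ->
  zp_eval t (zpmx_trmul M N) = c * d * \tr (A *m B).
Proof.
move=> MA NB; rewrite zp_eval_sum_iota /mxtrace mulr_sumr.
apply: eq_bigr => a _; rewrite zp_eval_sum_iota mxE mulr_sumr.
by apply: eq_bigr => k _; rewrite zp_evalM MA NB mulrACA.
Qed.

End ZPMatrix.

(** * Reification of the family *)

Inductive term := T0 | T1 | Tvar | Tnat of nat | Topp of term
  | Tadd of term & term | Tmul of term & term.

(* [(Some c, r0, r1, r2, r3)] stands for [c^-1 *: mx4 r0 r1 r2 r3]. *)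
Definition mx_term : Type :=
  option term * seq term * seq term * seq term * seq term.

Fixpoint term_poly (e : term) : zpoly :=
  match e with
  | T0 => [::]
  | T1 => [:: Zpos xH]
  | Tvar => [:: Z0; Zpos xH]
  | Tnat n => [:: Z.of_nat n]
  | Topp e => zp_scale (Zneg xH) (term_poly e)
  | Tadd e f => zp_add (term_poly e) (term_poly f)
  | Tmul e f => zp_mul (term_poly e) (term_poly f)
  end.

Definition eight_var : zpoly := [:: Z0; Zpos 8].

(* The quotient [8 t / c], exact for the denominators [k] and [k t]
   with [k] dividing 8. *)
Definition cofactor (c : option term) : zpoly :=
  if c is Some c then
    match term_poly c with
    | [:: k] => [:: Z0; Z.div 8 k]
    | [:: _; k] => [:: Z.div 8 k]
    | _ => [::]
    end
  else eight_var.

Definition cofactor_ok (m : mx_term) : bool :=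
  let: (c, _, _, _, _) := m in
  zp_eqb (zp_mul (cofactor c) (if c is Some c then term_poly c else term_poly T1))
         eight_var.

Definition mx_term_poly (m : mx_term) : zpmx :=
  let: (c, r0, r1, r2, r3) := m in
  [seq [seq zp_mul (cofactor c) (term_poly e) | e <- r] | r <- [:: r0; r1; r2; r3]].

Section TermEval.
Variables (R : realType) (t : R).

Fixpoint term_eval (e : term) : R :=
  match e with
  | T0 => 0
  | T1 => 1
  | Tvar => t
  | Tnat n => n%:R
  | Topp e => - term_eval e
  | Tadd e f => term_eval e + term_eval f
  | Tmul e f => term_eval e * term_eval f
  end.

Definition mx_term_eval (m : mx_term) : 'M[R]_4 :=
  let: (c, r0, r1, r2, r3) := m in
  let M := mx4 (map term_eval r0) (map term_eval r1)
               (map term_eval r2) (map term_eval r3) in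
  if c is Some c then (term_eval c)^-1 *: M else M.

Definition layer_term_eval (l : mx_term * mx_term * mx_term) : layer R :=
  (mx_term_eval l.1.1, mx_term_eval l.1.2, mx_term_eval l.2).

Lemma term_polyE e : zp_eval t (term_poly e) = term_eval e.
Proof.
elim: e => //=.
- by rewrite /Zr mulr0 addr0.
- by rewrite /Zr mulr0 addr0 add0r mulr1.
- move=> n; rewrite mulr0 addr0 /Zr.
  by have -> : int_of_Z (Z.of_nat n) = n by lia.
- by move=> e IH; rewrite zp_evalZ IH /Zr mulN1r.
- by move=> e IHe f IHf; rewrite zp_evalD IHe IHf.
- by move=> e IHe f IHf; rewrite zp_evalM IHe IHf.
Qed.

Lemma eight_varE : zp_eval t eight_var = 8 * t.
Proof. by rewrite /zp_eval /= /Zr mulr0 addr0 add0r mulrC. Qed.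

(** By [cofactor_ok], cofactor times denominator is [8 t], so scaling the bare rows by the cofactor
    is scaling the whole matrix by [8 t]. *)
Lemma mx_term_polyP m : t != 0 -> cofactor_ok m ->
  zpmx_repr t (8 * t) (mx_term_poly m) (mx_term_eval m).
Proof.
move=> t0; move: m => [[[[c r0] r1] r2] r3] /(zp_eval_eqb t).
rewrite zp_evalM eight_varE => E a b.
set M := mx4 (map term_eval r0) (map term_eval r1)
             (map term_eval r2) (map term_eval r3).
have -> : zp_eval t (zpmx_ent (mx_term_poly (c, r0, r1, r2, r3)) a b) =
    zp_eval t (cofactor c) * M a b.
  (* Rows are lists of any length; past their end both sides are zero by default. *)
  have nthE r : zp_eval t (nth [::] [seq zp_mul (cofactor c) (term_poly e) | e <- r] b)
      = zp_eval t (cofactor c) * nth 0 (map term_eval r) b.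
    have [lt|ge] := ltnP b (size r).
      by rewrite !(nth_map T0) // zp_evalM term_polyE.
    by rewrite !nth_default ?size_map //= mulr0.
  by rewrite mxE; case: a => [[|[|[|[|//]]]] ia] /=; rewrite -nthE.
rewrite -E /mx_term_eval -/M; case: c E => [c|] E; rewrite term_polyE in E *.
  (* A zero denominator would turn the cofactor identity into [0 = 8 t]. *)
  have c0 : term_eval c != 0.
    by apply: contraTneq isT => c0; move: E => /eqP;
       rewrite c0 mulr0 eq_sym mulf_eq0 pnatr_eq0 (negPf t0).
  by rewrite !mxE -mulrA mulVKf.
by rewrite /= mulr1.
Qed.

End TermEval.

Ltac reify_term t e :=
  lazymatch e with
  | t => constr:(Tvar)
  | @Algebra.zero _ => constr:(T0)
  | @GRing.one _ => constr:(T1)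
  | @Algebra.natmul _ (@GRing.one _) ?n => constr:(Tnat n)
  | @Algebra.opp _ ?a => let x := reify_term t a in constr:(Topp x)
  | @Algebra.add _ ?a ?b =>
      let x := reify_term t a in let y := reify_term t b in constr:(Tadd x y)
  | @GRing.mul _ ?a ?b =>
      let x := reify_term t a in let y := reify_term t b in constr:(Tmul x y)
  end.

Ltac reify_row t r :=
  lazymatch r with
  | nil => constr:(@nil term)
  | ?a :: ?r => let x := reify_term t a in let y := reify_row t r in constr:(x :: y)
  end.

Ltac reify_mx t m :=
  lazymatch m with
  | @mx4 _ ?a ?b ?c ?d =>
      let a := reify_row t a in let b := reify_row t b in
      let c := reify_row t c in let d := reify_row t d in
      constr:((None, a, b, c, d) : mx_term)
  | @GRing.scale _ _ (@GRing.inv _ ?k) (@mx4 _ ?a ?b ?c ?d) =>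
      let k := reify_term t k in
      let a := reify_row t a in let b := reify_row t b in
      let c := reify_row t c in let d := reify_row t d in
      constr:((Some k, a, b, c, d) : mx_term)
  end.

Ltac reify_layers t s :=
  lazymatch s with
  | nil => constr:(@nil (mx_term * mx_term * mx_term))
  | (?u, ?v, ?w) :: ?s =>
      let u := reify_mx t u in let v := reify_mx t v in
      let w := reify_mx t w in let s := reify_layers t s in
      constr:((u, v, w) :: s)
  end.

(** The terms are read off under binders for [R] and [t]; they mention neither, so the body can be
    extracted as a closed list. *)
Definition family_terms : seq (mx_term * mx_term * mx_term) :=
  ltac:(let f := constr:(fun (R : realType) (t : R) =>
          ltac:(let s := eval unfold family_seq in (family_seq t) in
                let d := reify_layers t s in exact d)) in
        lazymatch f with fun _ _ => ?d => exact d end).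

(** Evaluation undoes reification by conversion, so the reifying tactics need not be trusted. *)
Lemma family_termsE (R : realType) (t : R) :
  family_seq t = map (layer_term_eval t) family_terms.
Proof. reflexivity. Qed.

(** * Identities checked by computation *)

Definition layer_poly (l : mx_term * mx_term * mx_term) : zpmx * zpmx * zpmx :=
  (mx_term_poly l.1.1, mx_term_poly l.1.2, mx_term_poly l.2).

Definition family_polys : seq (zpmx * zpmx * zpmx) := map layer_poly family_terms.

Definition pow_eight_var n : zpoly := iter n (zp_mul eight_var) [:: Zpos xH].

Definition forall4 (P : nat -> bool) : bool := all P (iota 0 4).

(** The list [uv] is shared by all sixteen choices of [e] and [f]. The exponent 3 counts one factor
    [8 t] for each of the three matrices. *)
Definition mm_check (s : seq (zpmx * zpmx * zpmx)) : bool :=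
  forall4 (fun a => forall4 (fun b => forall4 (fun c => forall4 (fun d =>
    let uv := [seq (zp_mul (zpmx_ent l.1.1 a b) (zpmx_ent l.1.2 c d), l.2)
              | l <- s] in
    forall4 (fun e => forall4 (fun f =>
      zp_eqb (zp_sum [seq zp_mul p.1 (zpmx_ent p.2 e f) | p <- uv])
        (if [&& b == c, d == e & f == a] then pow_eight_var 3 else [::]))))))).

Definition gram_poly (s : seq zpmx) : zpoly :=
  zp_sum [seq zp_sum [seq let z := zpmx_trmul x y in zp_mul z z | y <- s]
         | x <- s].

Definition zp_loop (u v w : zpmx) : zpmx := zpmx_mul (zpmx_mul u v) w.

Lemma cofactor_family_terms :
  all (fun l => [&& cofactor_ok l.1.1, cofactor_ok l.1.2 & cofactor_ok l.2])
      family_terms.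
Proof. by vm_compute. Qed.

Lemma mm_check_family : mm_check family_polys.
Proof. by vm_compute. Qed.

(* The right-hand side is [(8 t)^12 (3328 + 512 t^2 + 2 / t^2)]. *)
Lemma gram_family_polys :
  zp_eqb (zp_add (gram_poly [seq zp_loop l.1.1 l.1.2 l.2 | l <- family_polys])
         (zp_add (gram_poly [seq zp_loop l.1.2 l.2 l.1.1 | l <- family_polys])
                 (gram_poly [seq zp_loop l.2 l.1.1 l.1.2 | l <- family_polys])))
    (zp_mul (pow_eight_var 10)
       [:: Zpos 128; Z0; Zpos 212992; Z0; Zpos 32768]).
Proof. by vm_compute. Qed.

(** * Invariance under the isotropy group *)

Section Invariant.
Variable R : realType.
Implicit Types (s : layers R) (l : layer R).

Definition loop3 (u v w : 'M[R]_4) : 'M[R]_4 := u *m v *m w.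
Definition loopU l := loop3 l.1.1 l.1.2 l.2.
Definition loopV l := loop3 l.1.2 l.2 l.1.1.
Definition loopW l := loop3 l.2 l.1.1 l.1.2.

(** The squared Frobenius norm of the Gram matrix of the [F (s i)] for the trace form. *)
Definition gram (F : layer R -> 'M[R]_4) s : R :=
  \sum_i \sum_j (\tr (F (s i) *m F (s j))) ^+ 2.

Definition gram_invariant s : R := gram loopU s + gram loopV s + gram loopW s.

Lemma eq_gram (F G : layer R -> 'M[R]_4) s s' :
  (forall i j, \tr (F (s' i) *m F (s' j)) = \tr (G (s i) *m G (s j))) ->
  gram F s' = gram G s.
Proof. by move=> E; do 2!apply: eq_bigr => ? _; rewrite E. Qed.

Lemma mxtrace_conj_mul (A X Y : 'M[R]_4) : A \in unitmx ->
  \tr (A *m X *m invmx A *m (A *m Y *m invmx A)) = \tr (X *m Y).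
Proof.
move=> uA; rewrite !mulmxA mulmxKV // mxtrace_mulC !mulmxA.
by rewrite mulVmx // mul1mx.
Qed.

(** The inner changes of basis cancel along the cycle; with the letters rotated, this serves all
    three loops. *)
Lemma loop3_conj (A B C u v w : 'M[R]_4) : B \in unitmx -> C \in unitmx ->
  loop3 (A *m u *m invmx B) (B *m v *m invmx C) (C *m w *m invmx A) =
  A *m loop3 u v w *m invmx A.
Proof. by move=> uB uC; rewrite /loop3 !mulmxA !mulmxKV. Qed.

Lemma loop3_scale a b c (u v w : 'M[R]_4) : a * b * c = 1 ->
  loop3 (a *: u) (b *: v) (c *: w) = loop3 u v w.
Proof.
move=> E; rewrite /loop3 -!(scalemxAl, scalemxAr) !scalerA.
by rewrite (_ : _ * _ = 1) ?scale1r // -E; ring.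
Qed.

Lemma loop3_tr (u v w : 'M[R]_4) : loop3 u^T v^T w^T = (loop3 w v u)^T.
Proof. by rewrite /loop3 !trmx_mul mulmxA. Qed.

Lemma gram_layer_perm F (p : 'S_48) s : gram F (layer_perm p s) = gram F s.
Proof.
rewrite /gram [RHS](reindex_inj (@perm_inj _ p)); apply: eq_bigr => i _.
rewrite [RHS](reindex_inj (@perm_inj _ p)); apply: eq_bigr => j _.
by rewrite !ffunE.
Qed.

Lemma gram_invariant_generator f s :
  isotropy_generator f -> gram_invariant (f s) = gram_invariant s.
Proof.
rewrite /gram_invariant; case=> {f} [A B C uA uB uC|k m k0 m0|p||].
- by congr (_ + _ + _); apply: eq_gram => i j;
    rewrite /loopU /loopV /loopW !ffunE /= !loop3_conj // mxtrace_conj_mul.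
- have E i : k i * m i * (k i * m i)^-1 = 1 by rewrite divff ?mulf_neq0.
  have E' i : m i * (k i * m i)^-1 * k i = 1 by rewrite mulrAC [m i * _]mulrC.
  have E'' i : (k i * m i)^-1 * k i * m i = 1 by rewrite -mulrA mulrC.
  congr (_ + _ + _); apply: eq_gram => i j;
    by rewrite /loopU /loopV /loopW !ffunE /= !loop3_scale.
- by rewrite !gram_layer_perm.
(* After the shift, [loopU], [loopV], [loopW] become the old [loopW], [loopU], [loopV]. *)
- rewrite [RHS]addrC [RHS]addrA; congr (_ + _ + _); apply: eq_gram => i j;
    by rewrite /loopU /loopV /loopW !ffunE.
(* Transposition reverses products: up to a transpose, [loopU] and [loopV] are exchanged and [loopW]
   is kept. *)
- rewrite [X in X + _]addrC; congr (_ + _ + _); apply: eq_gram => i j;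
    by rewrite /loopU /loopV /loopW !ffunE /= !loop3_tr -trmx_mul mxtrace_tr
               mxtrace_mulC.
Qed.

Lemma gram_invariant_isotropy (g : @algorithms R -> @algorithms R) :
  isotropy g -> forall x, gram_invariant (val (g x)) = gram_invariant (val x).
Proof.
elim=> {g} [f g fP gE x|//|g h _ IHg _ IHh x|g h _ IHg _ hK x].
- by rewrite gE gram_invariant_generator.
- by rewrite /= IHg IHh.
(* For the inverse [h], invariance under [g] is applied at the point [h x]. *)
- by rewrite -[in RHS](hK x) IHg.
Qed.

(** Being an algorithm, [s'] lies in its own orbit through the identity, hence in the orbit of
    [s]. *)
Lemma gram_invariant_orbit s s' : algorithms s' ->
  isotropy_orbit s = isotropy_orbit s' -> gram_invariant s = gram_invariant s'.
Proof.
move=> /mem_set s'P E.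
have : isotropy_orbit s s'.
  by rewrite E; exists id; [exact: isotropy_id|exists (SigSub s'P)].
by case=> g gI [x <- <-]; rewrite gram_invariant_isotropy.
Qed.

End Invariant.

(** * Transfer of the computed identities to the real family *)

Definition family_poly (i : 'I_48) : zpmx * zpmx * zpmx :=
  nth ([::], [::], [::]) family_polys i.

Section Family.
Variables (R : realType) (t : R).
Hypothesis t0 : t != 0.

Lemma big_family_polys (G : zpmx * zpmx * zpmx -> R) :
  \sum_(l <- family_polys) G l = \sum_(i < 48) G (family_poly i).
Proof. by rewrite (big_nth ([::], [::], [::])) big_mkord. Qed.

Lemma family_polyP i (l := family_poly i) (s := mm48_family t) :
  [/\ zpmx_repr t (8 * t) l.1.1 (U_ s i), zpmx_repr t (8 * t) l.1.2 (V_ s i)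
    & zpmx_repr t (8 * t) l.2 (W_ s i)].
Proof.
pose m0 : mx_term := (None, [::], [::], [::], [::]).
have lti : (i < size family_terms)%N by [].
rewrite /l /s /family_poly /family_polys /U_ /V_ /W_ ffunE.
rewrite family_termsE !(nth_map (m0, m0, m0)) //.
have /and3P[? ? ?] := all_nthP (m0, m0, m0) cofactor_family_terms i lti.
by split; apply: mx_term_polyP.
Qed.

Lemma pow_eight_varE n : zp_eval t (pow_eight_var n) = (8 * t) ^+ n.
Proof.
elim: n => [|n IH]; first by rewrite /= /Zr mulr0 addr0.
by rewrite zp_evalM IH eight_varE exprS.
Qed.

Lemma forall4P (a : 'I_4) (P : nat -> bool) : forall4 P -> P a.
Proof. by move/allP; apply; rewrite mem_iota /=. Qed.

Lemma family_algorithm : algorithms (mm48_family t).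
Proof.
apply/algorithmsP => a b c d e f.
have E : zp_eval t (zp_sum [seq zp_mul p.1 (zpmx_ent p.2 e f)
    | p <- [seq (zp_mul (zpmx_ent l.1.1 a b) (zpmx_ent l.1.2 c d), l.2)
           | l <- family_polys]]) =
    (8 * t) ^+ 3 * [&& b == c, d == e & f == a]%:R.
  transitivity (zp_eval t (if [&& val b == c, val d == e & val f == a]
                           then pow_eight_var 3 else [::])).
    apply: zp_eval_eqb; move: mm_check_family.
    move=> /(forall4P a)/(forall4P b)/(forall4P c)/(forall4P d).
    by move=> /(forall4P e)/(forall4P f).
  by rewrite !val_eqE; case: ifP => _; rewrite ?pow_eight_varE ?mulr1 ?mulr0.
(* The factor that cleared the denominators is nonzero and cancels. *)
have t8 : (8 * t) ^+ 3 != 0 by rewrite expf_neq0 // mulf_neq0 // pnatr_eq0.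
apply: (mulfI t8); rewrite -E zp_eval_sum big_map big_family_polys mulr_sumr.
apply: eq_bigr => i _; have [uP vP wP] := family_polyP i.
by rewrite /= !zp_evalM uP vP wP; ring.
Qed.

(** Each loop carries [(8 t) ^+ 3], so the trace of two loops carries the sixth power and its square
    the twelfth. *)
Lemma gram_family (F : layer R -> 'M[R]_4) (pF : zpmx * zpmx * zpmx -> zpmx) :
  (forall i, zpmx_repr t ((8 * t) ^+ 3) (pF (family_poly i)) (F (mm48_family t i))) ->
  zp_eval t (gram_poly (map pF family_polys)) =
  (8 * t) ^+ 12 * gram F (mm48_family t).
Proof.
move=> FP; rewrite zp_eval_sum big_map big_family_polys mulr_sumr.
apply: eq_bigr => i _; rewrite zp_eval_sum big_map big_family_polys mulr_sumr.
apply: eq_bigr => j _.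
by rewrite /= zp_evalM (zp_eval_trmul (FP i) (FP j)); ring.
Qed.

Lemma gram_invariant_family :
  gram_invariant (mm48_family t) = 3328 + 512 * t ^+ 2 + 2 / t ^+ 2.
Proof.
(* Stated for variables, so that this rewriting is done before the large concrete polynomials
   appear. *)
have evalE p q r m n : zp_eqb (zp_add p (zp_add q r)) (zp_mul m n) ->
    zp_eval t p + (zp_eval t q + zp_eval t r) = zp_eval t m * zp_eval t n.
  by move/(zp_eval_eqb t); rewrite !zp_evalD zp_evalM.
have loopP u v w (pu pv pw : zpmx) : zpmx_repr t (8 * t) pu u ->
    zpmx_repr t (8 * t) pv v -> zpmx_repr t (8 * t) pw w ->
    zpmx_repr t ((8 * t) ^+ 3) (zp_loop pu pv pw) (loop3 u v w).
  by move=> uP vP wP; rewrite 2!exprSr expr1; do 2?apply: zpmx_repr_mul.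
have := evalE _ _ _ _ _ gram_family_polys.
rewrite pow_eight_varE (gram_family (F := @loopU R)); last first.
  by move=> i; have [? ? ?] := family_polyP i; apply: loopP.
rewrite (gram_family (F := @loopV R)); last first.
  by move=> i; have [? ? ?] := family_polyP i; apply: loopP.
rewrite (gram_family (F := @loopW R)); last first.
  by move=> i; have [? ? ?] := family_polyP i; apply: loopP.
rewrite -!mulrDr addrA -/(gram_invariant _) => E.
have t8 : (8 * t) ^+ 12 != 0 by rewrite expf_neq0 // mulf_neq0 // pnatr_eq0.
apply: (mulfI t8); rewrite {}E.
rewrite /zp_eval /= /Zr.
by field.
Qed.

End Family.

(** * Separation of parameters within one interval *)

Lemma intervalsP (R : realType) (J : interval R) (t1 t2 : R) :
  J \in [:: `]-oo, - 4^-1]; `[- 4^-1, 0[; `]0, 4^-1]; `[4^-1, +oo[] ->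
  t1 \in J -> t2 \in J ->
  [\/ t1 <= - 4^-1 /\ t2 <= - 4^-1,
      - 4^-1 <= t1 < 0 /\ - 4^-1 <= t2 < 0,
      0 < t1 <= 4^-1 /\ 0 < t2 <= 4^-1
    | 4^-1 <= t1 /\ 4^-1 <= t2].
Proof.
move=> JP t1J t2J; move: JP; rewrite !inE => /or4P[]/eqP JE;
  move: t1J t2J; rewrite JE !in_itv /= ?andbT => ? ?;
  by [constructor 1|constructor 2|constructor 3|constructor 4].
Qed.

Lemma intervals_neq0 (R : realType) (J : interval R) (t : R) :
  J \in [:: `]-oo, - 4^-1]; `[- 4^-1, 0[; `]0, 4^-1]; `[4^-1, +oo[] ->
  t \in J -> t != 0.
Proof. by move=> JP tJ; apply/eqP; case: (intervalsP JP tJ tJ); lra. Qed.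

Lemma gram_value_inj (R : realType) (J : interval R) (t1 t2 : R) :
  J \in [:: `]-oo, - 4^-1]; `[- 4^-1, 0[; `]0, 4^-1]; `[4^-1, +oo[] ->
  t1 \in J -> t2 \in J ->
  3328 + 512 * t1 ^+ 2 + 2 / t1 ^+ 2 = 3328 + 512 * t2 ^+ 2 + 2 / t2 ^+ 2 ->
  t1 = t2.
Proof.
move=> JP t1J t2J E.
have [p q] := (intervals_neq0 JP t1J, intervals_neq0 JP t2J).
(* The difference of the two values is [2 (t1^2 - t2^2) (256 (t1 t2)^2 - 1) / (t1 t2)^2], whose
   numerator splits into linear factors in [t1]. *)
have : (t1 - t2) * (t1 + t2) * (16 * (t1 * t2) - 1) * (16 * (t1 * t2) + 1) = 0.
  transitivity ((3328 + 512 * t1 ^+ 2 + 2 / t1 ^+ 2 -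
    (3328 + 512 * t2 ^+ 2 + 2 / t2 ^+ 2)) * (t1 * t2) ^+ 2 / 2).
    by field; rewrite p q.
  by rewrite E subrr !mul0r.
move=> /eqP; rewrite !mulf_eq0 => /orP[/orP[/orP[]|]|] /eqP {}E.
- lra.
(* Both parameters are nonzero of the same sign, so their sum cannot vanish. *)
- by case: (intervalsP JP t1J t2J); lra.
(* Both absolute values lie on the same side of [1/4], so [t1 t2 = 1/16] forces both to equal
   [1/4]. *)
- by case: (intervalsP JP t1J t2J); nra.
(* A negative product contradicts the common sign. *)
- by case: (intervalsP JP t1J t2J); nra.
Qed.

Lemma family_orbit_inj (R : realType) (J : interval R) (t1 t2 : R) :
  J \in [:: `]-oo, - 4^-1]; `[- 4^-1, 0[; `]0, 4^-1]; `[4^-1, +oo[] ->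
  t1 \in J -> t2 \in J -> t1 <> t2 ->
  isotropy_orbit (mm48_family t1) <> isotropy_orbit (mm48_family t2).
Proof.
move=> JP t1J t2J t12 E; apply: t12; apply: (gram_value_inj JP t1J t2J).
have [p q] := (intervals_neq0 JP t1J, intervals_neq0 JP t2J).
rewrite -!gram_invariant_family //.
exact/gram_invariant_orbit/E/family_algorithm.
Qed.

(** * Rational coefficients and the infinite subfamily *)

Lemma zp_eval_ratr (R : realType) (q : rat) p :
  zp_eval (ratr q : R) p = ratr (zp_eval q p).
Proof.
by elim: p => [|a p IH] /=; rewrite ?rmorph0 // IH rmorphD rmorphM rmorph_int.
Qed.

(** Each entry is an integer polynomial in [t] divided by [8 t]; the same quotient at the rational
    [q] with [ratr q = t] is the witness. *)
Lemma family_rational (R : realType) (t : R) : t != 0 -> rationals t ->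
  rational_coefficients (mm48_family t).
Proof.
move=> t0 [q _ qt] i a b; have t8 : 8 * t != 0 by rewrite mulf_neq0 // pnatr_eq0.
have ratP M A : zpmx_repr t (8 * t) M A -> rationals (A a b).
  move=> MA; exists (zp_eval q (zpmx_ent M a b) / (8 * q)) => //.
  rewrite rmorphM /= fmorphV rmorphM /= rmorph_nat -zp_eval_ratr qt MA.
  by rewrite mulrC mulKf.
by have [/ratP ? /ratP ? /ratP ?] := family_polyP t0 i; split.
Qed.

Theorem mainTheorem1 (R : realType) :
  [/\ (forall t : R, t != 0 ->
         \sum_(i < 48) tensor3 (U_ (mm48_family t) i) (V_ (mm48_family t) i)
                               (W_ (mm48_family t) i) = mm_tensor R),
      (forall (J : interval R) (t1 t2 : R),
         J \in [:: `]-oo, - 4^-1]; `[- 4^-1, 0[; `]0, 4^-1]; `[4^-1, +oo[] ->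
         t1 \in J -> t2 \in J -> t1 <> t2 ->
         isotropy_orbit (mm48_family t1) <> isotropy_orbit (mm48_family t2))
    & let D := @rationals R `&` [set` `[4^-1, +oo[] in
      [/\ infinite_set (@mm48_family R @` D),
          (forall t, D t -> algorithms (mm48_family t)),
          (forall t, D t -> rational_coefficients (mm48_family t))
        & forall t1 t2, D t1 -> D t2 -> t1 <> t2 ->
            isotropy_orbit (mm48_family t1) <> isotropy_orbit (mm48_family t2)]].
Proof.
split; [exact: family_algorithm|exact: family_orbit_inj|].
move=> D; have D0 t : D t -> t != 0.
  by move=> [_ /=]; rewrite in_itv /= => ?; apply/eqP; lra.
have orbitP t1 t2 : D t1 -> D t2 -> t1 <> t2 ->
    isotropy_orbit (mm48_family t1) <> isotropy_orbit (mm48_family t2).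
  move=> [_ t1D] [_ t2D]; apply: (family_orbit_inj _ t1D t2D).
  by rewrite !inE eqxx !orbT.
split=> //; first last.
- by move=> t tD; apply: family_rational; [exact: D0|case: tD].
- by move=> t /D0; exact: family_algorithm.
(* The positive integers already give infinitely many parameters in [D]. *)
have DS (n : nat) : D n.+1%:R.
  split; first by exists n.+1%:R => //; rewrite rmorph_nat.
  by rewrite /= in_itv /= andbT -[n.+1]add1n natrD; have := ler0n R n; lra.
pose g n := mm48_family (n.+1%:R : R).
apply: (@sub_infinite_set _ (range g)).
  by move=> _ [n _ <-]; exists n.+1%:R.
(* Equal points have equal orbits, so [g] is injective by [orbitP]; a finite range would then make
   [nat] finite. *)
move=> gfin; apply: infinite_nat; rewrite -(preimage_range g).
apply: finite_preimage gfin => m n _ _ gmn; apply/eqP.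
rewrite -eqSS -(eqr_nat R); apply: contrapT => /negP/eqP mn.
by apply: (orbitP _ _ (DS m) (DS n) mn); rewrite -/(g m) gmn.
Qed.
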